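(* Let $T>0$, let $a,b,c:(0,T)\times(0,1)\to\mathbb{R}$ and $f:(0,T]\times(0,1)\to\mathbb{R}$ be functions with $\sup_{0<x<1,\,0<t\le T}|f(t,x)|<+\infty$. Let $u\in C^0([0,T]\times[0,1])$ be such that $u[t]\in C^2((0,1))$ for almost all $t\in(0,T)$, the derivative $\frac{\partial u}{\partial t}(t,x)$ exists and is a continuous function on $(0,T)\times[0,1]$, the derivatives $\frac{\partial u}{\partial x}(t,0)$, $\frac{\partial u}{\partial x}(t,1)$ exist for all $t\in(0,T]$, and $$\frac{\partial u}{\partial t}(t,x)=a(t,x)\frac{\partial^2u}{\partial x^2}(t,x)+b(t,x)\frac{\partial u}{\partial x}(t,x)+c(t,x)u(t,x)+f(t,x)$$ for almost all $t\in(0,T)$ and for all $x\in(0,1)$. Let $\mu_0,\mu_1>0$ and $\lambda_0,\lambda_1\in\mathbb{R}$ be given constants. Suppose that $a(t,x)\ge 0$ for all $t\in(0,T)$, $x\in(0,1)$, and that there exist a constant $\sigma>0$ and a positive function $\eta\in C^2([0,1];(0,+\infty))$ such that $$a(t,x)\eta''(x)+b(t,x)\eta'(x)+(\sigma+c(t,x))\eta(x)\le 0\quad\text{for all } t\in(0,T),\ x\in(0,1).$$ Suppose moreover that one of the following conditions holds: (A) $\mu_0\eta'(0)-\lambda_0\eta(0)<0$; (B) $\mu_1\eta'(1)+\lambda_1\eta(1)>0$; (C) $\mu_0\eta'(0)-\lambda_0\eta(0)<0$ and $\mu_1\eta'(1)+\lambda_1\eta(1)>0$. Then for all $\zeta\in[0,\sigma)$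 and $t\in(0,T]$: $$\|u[t]\|_{\infty,\eta}\le\max\left(\exp(-\zeta t)\|u[0]\|_{\infty,\eta},\ \sup_{0<s\le t}\left(\max\left(r_0(s),r_1(s),\frac{\|f[s]\|_{\infty,\eta}}{\sigma-\zeta}\right)\exp(-\zeta(t-s))\right)\right),$$ where $\|u[t]\|_{\infty,\eta}:=\max_{0\le x\le1}\frac{|u(t,x)|}{\eta(x)}$, $\|f[t]\|_{\infty,\eta}:=\sup_{0<x<1}\frac{|f(t,x)|}{\eta(x)}$, and $r_0,r_1$ are given for $t\in(0,T]$ as follows. If (A) holds: $$r_0(t):=\min\left(\frac{|u(t,0)|}{\eta(0)},\ \frac{1}{|\mu_0\eta'(0)-\lambda_0\eta(0)|}\left|\mu_0\frac{\partial u}{\partial x}(t,0)-\lambda_0u(t,0)\right|\right),\qquad r_1(t):=\frac{|u(t,1)|}{\eta(1)}.$$ If (B) holds: $$r_0(t):=\frac{|u(t,0)|}{\eta(0)},\qquad r_1(t):=\min\left(\frac{|u(t,1)|}{\eta(1)},\ \frac{1}{\mu_1\eta'(1)+\lambda_1\eta(1)}\left|\mu_1\frac{\partial u}{\partial x}(t,1)+\lambda_1u(t,1)\right|\right).$$ If (C) holds: $$r_0(t):=\min\left(\frac{|u(t,0)|}{\eta(0)},\ \frac{1}{|\mu_0\eta'(0)-\lambda_0\eta(0)|}\left|\mu_0\frac{\partial u}{\partial x}(t,0)-\lambda_0u(t,0)\right|\right),$$ $$r_1(t):=\min\left(\frac{|u(t,1)|}{\eta(1)},\ \frac{1}{\mu_1\eta'(1)+\lambda_1\eta(1)}\left|\mu_1\frac{\partial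 u}{\partial x}(t,1)+\lambda_1u(t,1)\right|\right).$$ (That is, under each of the conditions (A), (B), (C) the estimate holds with the corresponding choice of $r_0,r_1$.)
   Context: For a function $u$ of $(t,x)$, $u[t]$ denotes the profile at time $t$, i.e. $(u[t])(x)=u(t,x)$; similarly for $f[t]$. $C^k(U;\Omega)$ denotes the class of functions on $U$ with values in $\Omega$ having continuous derivatives up to order $k$ on $U$; $C^k(U)=C^k(U;\mathbb{R})$. ''Almost all'' refers to Lebesgue measure. $\eta',\eta''$ are derivatives with respect to $x\in[0,1]$. The derivatives $\frac{\partial u}{\partial x}(t,0)$ and $\frac{\partial u}{\partial x}(t,1)$ at the boundary points are one-sided derivatives. *)

(* Defs.v *)
From HB Require Import structures.
From mathcomp Require Export all_boot all_order all_algebra.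
From mathcomp Require Export all_classical all_reals all_analysis.
Export Order.TTheory GRing.Theory Num.Theory.
Export numFieldNormedType.Exports.

Set Implicit Arguments.
Unset Strict Implicit.
Unset Printing Implicit Defensive.

Local Open Scope ring_scope.
Local Open Scope classical_set_scope.

Section relative_derivative.
Context {R : realType}.
Implicit Types (A : set R) (f : R -> R) (x : R).

(* Increments [h] with [h + x \in A]: for [A = `[0, 1]] the derivatives below
   are the one-sided ones at 0 and 1 and only depend on the values on [A]. *)
Definition increments A x : set_system R := within [set h | A (h + x)] 0^'.

Definition derivable_in A f x : Prop :=
  cvg (h^-1 * (f (h + x) - f x) @[h --> increments A x]).

Definition derive_in A f x : R :=
  lim (h^-1 * (f (h + x) - f x) @[h --> increments A x]).

Definition derive_in_n A n f : R -> R := iter n (derive_in A) f.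

(* The class C^k(A), for [A] without isolated points. *)
Definition Ck k A f : Prop :=
  (forall i x, (i < k)%N -> A x -> derivable_in A (derive_in_n A i f) x) /\
  (forall i, (i <= k)%N -> {within A, continuous (derive_in_n A i f)}).

Lemma increments_open A x : open A -> A x -> increments A x = 0^'.
Proof.
move=> oA Ax.
have nA : \forall h \near (0 : R)^', A (h + x).
  apply: cvg_within.
  have : h + x @[h --> (0 : R)] --> 0 + x by apply: cvgD; [exact: cvg_id|exact: cvg_cst].
  by rewrite add0r; apply; apply: open_nbhs_nbhs.
rewrite /increments eqEsubset; split => P.
  by move=> wP; apply: filterS2 nA wP => h Ah; exact.
by move=> dP; apply: filterS dP => h Ph _.
Qed.

Lemma derivable_in_open A f x : open A -> A x ->
  derivable_in A f x <-> derivable f x 1.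
Proof.
move=> oA Ax; rewrite /derivable_in (increments_open oA Ax) /derivable.
suff -> : (fun h : R => h^-1 * (f (h + x) - f x)) =
          (fun h : R => h^-1 *: (f (h *: (1 : R) + x) - f x)) by [].
by apply/funext => h; rewrite /GRing.scale /= mulr1.
Qed.

Lemma derive_in_open A f x : open A -> A x -> derive_in A f x = f^`() x.
Proof. by move=> oA Ax; rewrite /derive_in (increments_open oA Ax). Qed.

Lemma derive_in_n_open A n f x : open A -> A x ->
  derive_in_n A n f x = f^`(n) x.
Proof.
move=> oA; elim: n x => [//|n IH] x Ax.
rewrite /derive_in_n iterS (derive_in_open _ oA Ax) derive1nS !derive1E.
apply: near_eq_derive.
by near=> y; apply: IH; near: y; exact: open_nbhs_nbhs.
Unshelve. all: by end_near. Qed.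

End relative_derivative.

Section boundary_terms.
Context {R : realType}.
Implicit Types (A : set R) (eta g : R -> R).

Definition wnorm A eta g : R := sup [set `|g x| / eta x | x in A].

(* On [0, 1] the supremum is the maximum used for continuous profiles. *)
Lemma wnorm_attained eta g :
  {within `[0, 1], continuous eta} -> {within `[0, 1], continuous g} ->
  (forall x, 0 <= x <= 1 -> 0 < eta x) ->
  exists2 x, 0 <= x <= 1 & wnorm `[0, 1] eta g = `|g x| / eta x /\
    forall y, 0 <= y <= 1 -> `|g y| / eta y <= `|g x| / eta x.
Proof.
move=> ceta cg eta0.
have cq : {within `[0, 1], continuous (fun x : R => `|g x| / eta x)}.
  apply/continuous_within_itvP => //.
  move/(continuous_within_itvP _ ltr01): ceta => [e1 e2 e3].
  move/(continuous_within_itvP _ ltr01): cg => [g1 g2 g3].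
  split => [x x01||].
  - apply: cvgM; first by apply: cvg_norm; exact: g1.
    apply: cvgV; last exact: e1.
    by rewrite gt_eqF// eta0//; move: x01; rewrite in_itv /= => /andP[/ltW-> /ltW->].
  - apply: cvgM; first exact: cvg_norm.
    by apply: cvgV => //; rewrite gt_eqF// eta0// lexx ler01.
  - apply: cvgM; first exact: cvg_norm.
    by apply: cvgV => //; rewrite gt_eqF// eta0// lexx ler01.
have [c c01 cmax] := EVT_max ler01 cq.
have cm y : 0 <= y <= 1 -> `|g y| / eta y <= `|g c| / eta c.
  by move=> y01; apply: cmax; rewrite in_itv.
exists c; first by move: c01; rewrite in_itv.
split=> //; apply/eqP; rewrite eq_le; apply/andP; split.
  apply: ge_sup; first by exists (`|g c| / eta c); exists c.
  by move=> _ [y + <-]; rewrite /= in_itv /=; exact: cm.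
apply: ub_le_sup; last by exists c.
exists (`|g c| / eta c) => _ [y + <-]; rewrite /= in_itv /=; exact: cm.
Qed.

Definition dirichlet eta (u : R -> R -> R) x t : R := `|u t x| / eta x.

Definition robin0 mu0 lambda0 eta : R :=
  mu0 * derive_in `[0, 1] eta 0 - lambda0 * eta 0.

Definition robin1 mu1 lambda1 eta : R :=
  mu1 * derive_in `[0, 1] eta 1 + lambda1 * eta 1.

Definition mixed0 mu0 lambda0 eta (u : R -> R -> R) t : R :=
  Num.min (dirichlet eta u 0 t)
    (`|robin0 mu0 lambda0 eta|^-1 * `|robin0 mu0 lambda0 (u t)|).

Definition mixed1 mu1 lambda1 eta (u : R -> R -> R) t : R :=
  Num.min (dirichlet eta u 1 t)
    ((robin1 mu1 lambda1 eta)^-1 * `|robin1 mu1 lambda1 (u t)|).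

Definition estimate (T sigma : R) eta (u f : R -> R -> R) (r0 r1 : R -> R) :=
  forall zeta t : R, 0 <= zeta < sigma -> 0 < t <= T ->
    wnorm `[0, 1] eta (u t) <=
      Num.max (expR (- zeta * t) * wnorm `[0, 1] eta (u 0))
        (sup [set Num.max (Num.max (r0 s) (r1 s))
                    (wnorm (`]0, 1[) eta (f s) / (sigma - zeta))
                  * expR (- zeta * (t - s)) | s in (`]0, t])]).

End boundary_terms.

(* Main.v *)
From mathcomp Require Import ring lra.
Require Import Defs.

(** Put w(s, x) = |u(s, x)| exp(zeta s). The estimate says that w(t, x) stays
    below C eta(x), where C is the right-hand side of the estimate multiplied
    by exp(zeta t); with this C, the boundary data and |f| / ((sigma - zeta) eta) at
    a time s in ]0, t] are at most C exp(- zeta s). Three facts carry the proof.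

    Spatial maximum ([elliptic_at_interior_max], [dirichlet_le_mixed0],
    [dirichlet_le_mixed1]). Let s be a time at which the equation holds, and
    let |u(s, .)| / eta be maximal at x with value m. Then e u(s, .), with e the
    sign of u(s, x), touches m eta from below at x. If x is interior, the first
    derivatives agree and the second ones are ordered, so the supersolution
    inequality for eta gives e u_t <= - sigma m eta + |f|. If x is an endpoint,
    the one-sided derivatives are ordered, and the sign of the Robin expression
    of eta bounds m by the mixed boundary datum.

    Last time ([weighted_sup_bound]). Suppose that w exceeds C eta somewhere at
    time t. Compare w with (C + g/2 + k s) eta(x), where g is the excess of
    w / eta over C and k > 0 is small, and let p be the last time at which w is
    below this barrier for all x. Then 0 < p < t. For s slightly larger than p, the maximum point x
    of |u(s, .)| / eta lies strictly above the barrier, while at time p it was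
    below. By the mean value theorem the derivative in time of
    e u(., x) exp(zeta .) exceeds k eta(x) somewhere in ]p, s[. As u_t is
    continuous on ]0, T[ x [0, 1], and [0, 1] is compact, this derivative
    oscillates by less than k min eta near p, uniformly in x ([tube_lt]), hence
    it is still positive at time s. This contradicts the behaviour at a spatial
    maximum, where the data are too small to let |u| exp(zeta .) grow.

    Exceptional times. The contradiction needs only one time s in ]p, p + d[ at
    which the equation holds, and such times exist because a null set contains
    no interval ([ae_between]). Hence no differentiation of the maximum
    function and no absolute continuity is involved. *)

Local Open Scope ring_scope.
Local Open Scope classical_set_scope.
Set Implicit Arguments.
Unset Strict Implicit.
Unset Printing Implicit Defensive.

(** * Continuity, compactness and null sets *)

Lemma within_continuous_comp (X Y Z : topologicalType) (A : set X) (B : set Y)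
    (g : X -> Y) (h : Y -> Z) :
  {within A, continuous g} -> (forall x, A x -> B (g x)) ->
  {within B, continuous h} -> {within A, continuous (h \o g)}.
Proof.
move=> /subspace_continuousP cg gAB /subspace_continuousP ch.
apply/subspace_continuousP => x Ax.
have W : g y @[y --> within A (nbhs x)] --> within B (nbhs (g x)).
  move=> P /= wP.
  have /cg : A x by [].
  move=> /(_ _ wP); rewrite /nbhs /= /within /=.
  by apply: filterS => y Py Ay; apply: Py => //; exact: gAB.
exact: cvg_comp W (ch _ (gAB _ Ax)).
Qed.

Lemma within_continuous_pairl (X Y Z : topologicalType) (A : set X) (B : set Y)
    (h : X * Y -> Z) (y : Y) : B y ->
  {within A `*` B, continuous h} -> {within A, continuous (fun x => h (x, y))}.
Proof.
move=> By ch; apply: (within_continuous_comp (g := fun x => (x, y))) ch; last by [].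
by apply: continuous_subspaceT => x; apply: cvg_pair; [exact: cvg_id|exact: cvg_cst].
Qed.

Lemma within_continuous_pairr (X Y Z : topologicalType) (A : set X) (B : set Y)
    (h : X * Y -> Z) (x : X) : A x ->
  {within A `*` B, continuous h} -> {within B, continuous (fun y => h (x, y))}.
Proof.
move=> Ax ch; apply: (within_continuous_comp (g := fun y => (x, y))) ch; last by [].
by apply: continuous_subspaceT => y; apply: cvg_pair; [exact: cvg_cst|exact: cvg_id].
Qed.

(** Compactness of [K] makes continuity in the first variable uniform in the
    second one: finitely many product neighbourhoods cover [{p} x K]. *)
Lemma tube_lt (R : realType) (X Y : topologicalType) (A : set X) (K : set Y)
    (phi : X * Y -> R) (p : X) (e : R) :
  compact K -> {within A `*` K, continuous phi} -> A p -> 0 < e ->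
  \forall s \near p, A s -> forall y, K y -> `|phi (s, y) - phi (p, y)| < e.
Proof.
move=> /compact_near_coveringP cK /subspace_continuousP cphi Ap e0.
have e20 : 0 < e / 2 by rewrite divr_gt0.
suff : \forall s \near p,
    K `<=` [set y | A s -> K y -> `|phi (s, y) - phi (p, y)| < e].
  by apply: filterS => s Hs As y Ky; exact: Hs.
apply: (cK X (nbhs p) (fun s y => A s -> K y -> `|phi (s, y) - phi (p, y)| < e)).
move=> y Ky.
have H : \forall z \near (p, y), (A `*` K) z -> `|phi z - phi (p, y)| < e / 2.
  have /cphi /cvgrPdist_lt /(_ _ e20) : (A `*` K) (p, y) by [].
  rewrite near_withinE /=; apply: filterS => z Hz Az; rewrite distrC; exact: Hz.
have [[U V] /= [Up Vy] UV] := H.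
exists (V, U) => //= -[y' s] /= [Vy' Us] As Ky'.
rewrite (splitr e) -(subrKA (phi (p, y))).
apply: (le_lt_trans (ler_normD _ _)); apply: ltrD.
  exact: (UV (s, y')).
by rewrite distrC; apply: (UV (p, y')) => //; split=> //=; exact: nbhs_singleton.
Qed.

(** A null set cannot contain an open interval, so a property true almost
    everywhere has instances as close to the right of [p] as wanted. *)
Lemma ae_between (R : realType) (P : R -> Prop) (p q : R) : p < q ->
  {ae @lebesgue_measure R, forall s, P s} -> exists2 s, p < s < q & P s.
Proof.
move=> pq [N [mN N0 PN]]; apply: contrapT => H.
have sub : [set` `]p, q[%R] `<=` N.
  move=> s /=; rewrite in_itv /= => psq; apply: PN => /= Ps.
  by apply: H; exists s.
have : (lebesgue_measure [set` `]p, q[%R] <= @lebesgue_measure R N)%E.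
  by apply: le_measure => //; rewrite inE; [exact: measurable_itv|].
rewrite N0 lebesgue_measure_itv /= lte_fin pq -EFinD lee_fin.
by rewrite leNgt subr_gt0 pq.
Qed.

Lemma ae_and (R : realType) (P Q : R -> Prop) :
  {ae @lebesgue_measure R, forall s, P s} ->
  {ae @lebesgue_measure R, forall s, Q s} ->
  {ae @lebesgue_measure R, forall s, P s /\ Q s}.
Proof.
move=> aeP aeQ.
exact: (@filterI _ (almost_everywhere (@lebesgue_measure R))
  (ae_filter_ringOfSetsType lebesgue_measure) _ _ aeP aeQ).
Qed.

Lemma exists_pos_lt2 (R : realType) (r d : R) : 0 < r -> 0 < d ->
  exists h, [/\ 0 < h, h < r & h < d].
Proof.
move=> r0 d0; have m0 : 0 < Num.min r d by rewrite lt_min r0.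
exists (Num.min r d / 2); split; first by rewrite divr_gt0.
  by rewrite (@lt_le_trans _ _ (Num.min r d)) ?ge_min ?lexx// ltr_pdivrMr// ltr_pMr// ltr1n.
by rewrite (@lt_le_trans _ _ (Num.min r d)) ?ge_min ?lexx ?orbT//
           ltr_pdivrMr// ltr_pMr// ltr1n.
Qed.

Lemma sg_mul_le (R : realType) (y z : R) : Num.sg y * z <= `|z|.
Proof.
rewrite (le_trans (ler_norm _))// normrM normr_sg ler_piMl//.
by case: (y != 0).
Qed.

Lemma continuous_pos_lower_bound (R : realType) (a b : R) (eta : R -> R) : a <= b ->
  {within `[a, b], continuous eta} -> (forall x, a <= x <= b -> 0 < eta x) ->
  exists2 m, 0 < m & forall x, a <= x <= b -> m <= eta x.
Proof.
move=> ab ceta eta0.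
have [c cab cmin] := EVT_min ab ceta.
exists (eta c); first by apply: eta0; move: cab; rewrite in_itv.
by move=> x xab; apply: cmin; rewrite in_itv.
Qed.

Lemma closed_le0_within (R : realType) (X : topologicalType) (A : set X) (h : X -> R) :
  closed A -> {within A, continuous h} -> closed (A `&` [set x | h x <= 0]).
Proof.
move=> cA /continuous_closedP ch; rewrite setIC.
have := ch _ (@closed_le _ (0 : R)); rewrite -(closed_setIS _ cA); exact.
Qed.

(** The set is closed, so it contains its supremum. *)
Lemma last_time (R : realType) (S : set R) (t : R) : closed S -> S 0 -> ~ S t -> 0 < t ->
  S `<=` `[0, t] ->
  exists p, [/\ 0 <= p < t, S p & forall s, p < s -> ~ S s].
Proof.
move=> cS S0 St t0 St0.
have ubS : ubound S t by move=> s /St0 /=; rewrite in_itv /= => /andP[].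
have hS : has_sup S by split; [exists 0|exists t].
have Sp : S (sup S).
  by apply: cS; apply: closure_sup; [exists 0|exists t].
exists (sup S); split => //.
- rewrite (ub_le_sup hS.2 S0) /= lt_neqAle; apply/andP; split.
    by apply/eqP => E; apply: St; rewrite -E.
  by apply: ge_sup => //; exists 0.
- by move=> s ps Ss; move: ps; rewrite ltNge (ub_le_sup hS.2 Ss).
Qed.

(** * Derivatives relative to a set *)

Section derivatives.
Context {R : realType}.
Implicit Types (A : set R) (f g q : R -> R).

(** Ties the derivatives relative to a set, in which [eta] is differentiated on
    [[0, 1]], to the ordinary derivatives of the equation. *)
Lemma increments_interior A x : A° x -> increments A x = 0^'.
Proof.
move=> Ax; rewrite -(increments_open (@open_interior _ A) Ax).
have shiftA : h + x @[h --> (0 : R)^'] --> x.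
  have S : h + x @[h --> (0 : R)] --> 0 + x.
    by apply: cvgD; [exact: cvg_id|exact: cvg_cst].
  by rewrite add0r in S; apply: cvg_trans S; apply: cvg_app; exact: cvg_within.
rewrite eqEsubset; split => P; rewrite /increments /within /=.
  by apply: (@filterS _ (0 : R)^') => h Ph Ah; apply: Ph; exact: interior_subset Ah.
have /shiftA : nbhs x A° by apply: open_nbhs_nbhs; split=> //; exact: open_interior.
by apply: (@filterS2 _ (0 : R)^') => h Ah Ph _; exact: Ph.
Qed.

Lemma derivable_in_interior A f x : A° x ->
  derivable_in A f x <-> derivable f x 1.
Proof.
move=> Ax; rewrite -(derivable_in_open f (@open_interior _ A) Ax).
by rewrite /derivable_in increments_interior// increments_open//; exact: open_interior.
Qed.

Lemma derive_in_n_interior A n f x : A° x ->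
  derive_in_n A n f x = derive1n n f x.
Proof.
elim: n x => [//|n IH] x Ax.
rewrite /derive_in_n iterS /derive_in (increments_interior Ax).
rewrite -/(derive1 (iter n (derive_in A) f) x) derive1nS !derive1E.
apply: near_eq_derive; near=> y; apply: IH; near: y.
by apply: open_nbhs_nbhs; split=> //; exact: open_interior.
Unshelve. all: by end_near. Qed.

Lemma Ck2_interior A f x : Ck 2 A f -> A° x ->
  (\forall y \near x, derivable f y 1) /\ derivable (derive1 f) x 1.
Proof.
move=> [df _] Ax.
have nA : \forall y \near x, A° y.
  by apply: open_nbhs_nbhs; split=> //; exact: open_interior.
split.
  near=> y; have Ay : A° y by near: y.
  exact: (derivable_in_interior f Ay).1 (df 0%N _ isT (interior_subset Ay)).
have := df 1%N x isT (interior_subset Ax).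
move/(derivable_in_interior _ Ax); apply: near_eq_derivable.
near=> y; have Ay : A° y by near: y.
by rewrite (derive_in_n_interior _ _ Ay) derive1n1.
Unshelve. all: by end_near. Qed.

Lemma interior_oo (a b x : R) : a < x < b -> interior (`]a, b[ : set R) x.
Proof.
move=> xab; apply: open_nbhs_nbhs; split; first exact: interval_open.
by rewrite /= in_itv.
Qed.

Lemma interior_cc (a b x : R) : a < x < b -> interior (`[a, b] : set R) x.
Proof.
move=> /interior_oo; apply: interiorS; exact: subset_itv_oo_cc.
Qed.

(** * Touching functions *)

(** If the second derivative at [x] were positive, the first derivative, which
    vanishes at [x], would be positive just to the right of [x], and [q] would
    increase there. *)
Lemma local_max_derive2 q x :
  (\forall y \near x, derivable q y 1) -> derivable (derive1 q) x 1 ->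
  (\forall y \near x, q y <= q x) ->
  derive1 q x = 0 /\ derive1n 2 q x <= 0.
Proof.
move=> dq dq' qmax.
have /(nbhs_ballP) [r /= r0 Hr] :
  \forall y \near x, derivable q y 1 /\ q y <= q x by near=> y; split; near: y.
have inr y : y \in `]x - r, x + r[%R -> ball x r y.
  by rewrite in_itv /= /ball /= ltr_distlC.
have xin : x \in `]x - r, x + r[%R by rewrite in_itv /= ltrBlDr !ltrDl r0.
have ab : x - r <= x + r by lra.
have q'0 : derive1 q x = 0.
  rewrite derive1E; apply: derive_val.
  apply: (derive1_at_max ab _ xin) => y yin; first exact: (Hr _ (inr _ yin)).1.
  exact: (Hr _ (inr _ yin)).2.
split=> //; rewrite leNgt; apply/negP => q''0.
have cq : (h : R)^-1 *: (derive1 q (h *: (1 : R) + x) - derive1 q x) @[h --> 0^']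
    --> derive1n 2 q x.
  rewrite [derive1n 2 q x](derive1E (derive1 q) x); exact: dq'.
have /nbhs_ballP [d /= d0 Hd] : \forall h \near 0, h != 0 ->
    0 < h^-1 *: (derive1 q (h *: (1 : R) + x) - derive1 q x).
  exact: (cvgr_gt _ cq _ q''0).
have [h [h0 hr hd]] := exists_pos_lt2 r0 d0.
have dqx y : x <= y <= x + h -> derivable q y 1.
  move=> /andP[xy yh]; apply: (Hr _ _).1; apply: inr; rewrite in_itv /=; lra.
have [c] : exists2 c, c \in `]x, x + h[%R & q (x + h) - q x = derive1 q c * (x + h - x).
  apply: MVT; first by rewrite ltrDl.
    move=> y; rewrite in_itv /= => /andP[xy yh].
    by rewrite derive1E; apply/derivableP/dqx; rewrite !ltW.
  by apply: derivable_within_continuous => y; rewrite in_itv /=; exact: dqx.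
rewrite in_itv /= => /andP[xc cxh] E.
have cx0 : 0 < c - x by rewrite subr_gt0.
have := Hd (c - x); rewrite /ball /= sub0r normrN gtr0_norm//.
rewrite /GRing.scale /= mulr1 subrK q'0 subr0 => /(_ _ (lt0r_neq0 cx0)).
rewrite pmulr_rgt0 ?invr_gt0// => q'c.
have : q (x + h) <= q x.
  by apply: (Hr _ _).2; apply: inr; rewrite in_itv /=; lra.
have {}q'c : 0 < derive1 q c by apply: q'c; lra.
rewrite -subr_le0 E leNgt => /negP; apply.
by rewrite mulr_gt0// addrAC subrr add0r.
Unshelve. all: by end_near. Qed.

(** The difference [f - g] has a local maximum at [x]. *)
Lemma touching_derive2 f g x :
  (\forall y \near x, derivable f y 1) -> derivable (derive1 f) x 1 ->
  (\forall y \near x, derivable g y 1) -> derivable (derive1 g) x 1 ->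
  (\forall y \near x, f y <= g y) -> f x = g x ->
  derive1 f x = derive1 g x /\ derive1n 2 f x <= derive1n 2 g x.
Proof.
move=> df df' dg dg' fg fgx.
have E (y : R) : derivable f y 1 -> derivable g y 1 ->
    derive1 (f - g) y = derive1 f y - derive1 g y.
  move=> dfy dgy.
  by rewrite [LHS]derive1E (deriveB dfy dgy) [X in _ = X - _]derive1E
             [X in _ = _ - X]derive1E.
have nE : {near x, (derive1 f - derive1 g) =1 derive1 (f - g)}.
  by apply: filterS2 df dg => y dfy dgy; rewrite (E y dfy dgy).
have D : derive1 (f - g) x = 0 /\ derive1n 2 (f - g) x <= 0.
  apply: local_max_derive2.
  - by apply: filterS2 df dg => y dfy dgy; exact: derivableB.
  - exact: (near_eq_derivable nE (derivableB df' dg')).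
  - by apply: filterS fg => y fgy; rewrite !fctE fgx subrr subr_le0.
split.
  apply/eqP; rewrite -subr_eq0 -(E x (nbhs_singleton df) (nbhs_singleton dg)).
  by rewrite D.1.
rewrite -subr_le0; apply: le_trans D.2.
rewrite [derive1n 2 f x](derive1E (derive1 f) x).
rewrite [derive1n 2 g x](derive1E (derive1 g) x) -(deriveB df' dg').
by rewrite [derive1n 2 (f - g) x](derive1E (derive1 (f - g)) x) (near_eq_derive _ nE).
Qed.

Lemma proper_increments_left (a b : R) : a < b ->
  ProperFilter (increments `[a, b] a).
Proof.
move=> ab; split.
  rewrite /increments /within /= => /nbhs_ballP [d /= d0 /=] H.
  have ba0 : 0 < b - a by rewrite subr_gt0.
  have [h [h0 hr hd]] := exists_pos_lt2 ba0 d0.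
  apply: (H h); rewrite /ball /= ?sub0r ?normrN ?gtr0_norm ?gt_eqF//.
  by rewrite in_itv /=; lra.
exact: within_filter.
Qed.

Lemma proper_increments_right (a b : R) : a < b ->
  ProperFilter (increments `[a, b] b).
Proof.
move=> ab; split.
  rewrite /increments /within /= => /nbhs_ballP [d /= d0 /=] H.
  have ba0 : 0 < b - a by rewrite subr_gt0.
  have [h [h0 hr hd]] := exists_pos_lt2 ba0 d0.
  apply: (H (- h)); rewrite /ball /= ?sub0r ?opprK ?gtr0_norm ?oppr_eq0 ?gt_eqF//.
  by rewrite in_itv /=; lra.
exact: within_filter.
Qed.

Lemma derive_in_scale A f x (k : R) : ProperFilter (increments A x) ->
  derivable_in A f x ->
  derivable_in A (fun y => k * f y) x /\
  derive_in A (fun y => k * f y) x = k * derive_in A f x.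
Proof.
move=> PF df.
have H : h^-1 * (k * f (h + x) - k * f x) @[h --> increments A x] -->
    k * derive_in A f x.
  rewrite (_ : (fun h => _) = (fun h => k * (h^-1 * (f (h + x) - f x)))).
    by apply: cvgM; [exact: cvg_cst|exact: df].
  by apply/funext => h; rewrite -mulrBr mulrCA.
by split; [apply/cvg_ex; eexists; exact: H|apply: cvg_lim].
Qed.

(** At the left endpoint all increments are positive, hence the difference
    quotients are ordered like the functions; at the right endpoint, below, the
    order is reversed. *)
Lemma touching_derive_left (a b : R) f g : a < b ->
  derivable_in `[a, b] f a -> derivable_in `[a, b] g a ->
  (forall y, a <= y <= b -> f y <= g y) -> f a = g a ->
  derive_in `[a, b] f a <= derive_in `[a, b] g a.
Proof.
move=> ab df dg fg fga.
have PF := proper_increments_left ab.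
apply: ler_lim => //.
apply: (@filterE _ (0 : R)^') => h /=; rewrite in_itv /= => hab.
have h0 : 0 <= h by lra.
by rewrite ler_wpM2l ?invr_ge0// fga lerB// fg.
Qed.

Lemma touching_derive_right (a b : R) f g : a < b ->
  derivable_in `[a, b] f b -> derivable_in `[a, b] g b ->
  (forall y, a <= y <= b -> f y <= g y) -> f b = g b ->
  derive_in `[a, b] g b <= derive_in `[a, b] f b.
Proof.
move=> ab df dg fg fgb.
have PF := proper_increments_right ab.
apply: ler_lim => //.
apply: (@filterE _ (0 : R)^') => h /=; rewrite in_itv /= => hab.
have h0 : h <= 0 by lra.
by rewrite ler_wnM2l ?invr_le0// fgb lerB// fg.
Qed.

Lemma derive2_scale (k : R) (f : R -> R) x :
  (\forall y \near x, derivable f y 1) -> derivable (derive1 f) x 1 ->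
  let g := fun y => k * f y in
  [/\ (\forall y \near x, derivable g y 1), derivable (derive1 g) x 1,
      derive1 g x = k * derive1 f x & derive1n 2 g x = k * derive1n 2 f x].
Proof.
move=> df df' g.
have dg y : derivable f y 1 -> derivable g y 1 by move=> dfy; exact: derivableZ.
have E (y : R) : derivable f y 1 -> derive1 g y = k * derive1 f y.
  move=> dfy; rewrite [LHS]derive1E [X in _ = _ * X]derive1E.
  exact: (deriveMl k dfy).
have nE : {near x, (k \*: derive1 f) =1 derive1 g}.
  by apply: filterS df => y dfy; rewrite (E y dfy).
split.
- by apply: filterS df => y; exact: dg.
- exact: (near_eq_derivable nE (derivableZ df')).
- exact: (E x (nbhs_singleton df)).
- rewrite [derive1n 2 g x](derive1E (derive1 g) x).
  by rewrite [derive1n 2 f x](derive1E (derive1 f) x) -(near_eq_derive _ nE) deriveZ.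
Qed.

(** With [e] the sign of the solution at a fixed point, this is the growth rate
    of its exponentially weighted absolute value. *)
Lemma is_derive_expR_weighted (zeta e r du : R) (u : R -> R) :
  is_derive r 1 u du ->
  is_derive r 1 (fun s => e * u s * expR (zeta * s))
    (e * ((du + zeta * u r) * expR (zeta * r))).
Proof.
move=> Du.
have Dlin : is_derive r 1 ( *%R zeta) zeta.
  have := is_deriveZ zeta (is_derive_id r (1 : R)).
  by rewrite /GRing.scale /= mulr1.
have Dexp : is_derive r 1 (fun s => expR (zeta * s)) (zeta * expR (zeta * r)).
  by rewrite mulrC; exact: is_derive1_comp (is_derive_expR (zeta * r)) Dlin.
have := is_deriveM (is_deriveZ e Du) Dexp.
move/is_derive_eq; apply; rewrite /GRing.scale /= /GRing.scale /=; ring.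
Qed.

End derivatives.

(** * Behaviour at a spatial maximum *)

Section maximum_principle.
Context {R : realType}.

(** [e * v] touches [m * eta] from below at [x]: the zeroth and first order terms
    agree, the second order term is ordered since [a] is nonnegative, so the
    operator at [e * v] is at most [m] times the operator at [eta], to which the
    supersolution inequality applies. *)
Lemma elliptic_at_interior_max (v eta : R -> R) (m e a b c sigma x : R) :
  Ck 2 `]0, 1[ v -> Ck 2 `[0, 1] eta -> 0 < x < 1 -> 0 <= m ->
  (forall y, 0 <= y <= 1 -> e * v y <= m * eta y) -> e * v x = m * eta x ->
  0 <= a ->
  a * derive_in_n `[0, 1] 2 eta x + b * derive_in `[0, 1] eta x
    + (sigma + c) * eta x <= 0 ->
  e * (a * derive1n 2 v x + b * derive1 v x + c * v x) <= - sigma * (m * eta x).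
Proof.
move=> Cv Ceta x01 m0 le_v eq_v a0.
have xi := interior_cc x01.
rewrite (derive_in_n_interior 2 _ xi) -[derive_in _ _ _]/(derive_in_n _ 1 _ _).
rewrite (derive_in_n_interior 1 _ xi).
have -> : derive1n 1 eta x = derive1 eta x by [].
have [dv dv'] := Ck2_interior Cv (interior_oo x01).
have [deta deta'] := Ck2_interior Ceta xi.
have [dev dev' ev1 ev2] := derive2_scale e dv dv'.
have [dme dme' me1 me2] := derive2_scale m deta deta'.
have near_le : \forall y \near x, e * v y <= m * eta y.
  apply: filterS xi => y /=; rewrite in_itv; exact: le_v.
have [] := touching_derive2 dev dev' dme dme' near_le eq_v.
rewrite ev1 me1 ev2 me2 => E1 E2 H.
have {}H := mulr_ge0_le0 m0 H.
have {}E2 := ler_wpM2l a0 E2.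
rewrite (_ : e * _ = a * (e * derive1n 2 v x) + b * (e * derive1 v x)
                     + c * (e * v x)); last by ring.
rewrite E1 eq_v; move: E2 H.
move: (derive1n 2 eta x) (derive1 eta x) (derive1n 2 v x) (eta x) => X Y Z W.
move=> E2 H; clear -E2 H; lra.
Qed.

(** If the weighted maximum [m] is attained at 0, then [e * u t] touches [m * eta]
    from below there, where [e] is the sign of [u t 0]. Hence
    [e * robin0 (u t) <= m * robin0 eta], and this is nonpositive, so
    [|robin0 (u t)| >= m * |robin0 eta|]. *)
Lemma dirichlet_le_mixed0 (mu0 lambda0 : R) (eta : R -> R) (u : R -> R -> R) (t : R) :
  0 < mu0 -> robin0 mu0 lambda0 eta < 0 ->
  derivable_in `[0, 1] eta 0 -> derivable_in `[0, 1] (u t) 0 ->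
  (forall y, 0 <= y <= 1 -> 0 < eta y) ->
  (forall y, 0 <= y <= 1 -> `|u t y| / eta y <= `|u t 0| / eta 0) ->
  dirichlet eta u 0 t <= mixed0 mu0 lambda0 eta u t.
Proof.
move=> mu00 rob deta du eta0 umax.
have e00 : 0 < eta 0 by apply: eta0; rewrite lexx ler01.
rewrite /mixed0 le_min lexx /= /dirichlet.
set m := `|u t 0| / eta 0; set e := Num.sg (u t 0).
have PF := proper_increments_left (@ltr01 R).
have [dev Eev] := derive_in_scale e PF du.
have [dme Eme] := derive_in_scale m PF deta.
have eq0 : e * u t 0 = m * eta 0.
  by rewrite -normrEsg /m divfK// gt_eqF.
have : derive_in `[0, 1] (fun y => e * u t y) 0 <=
       derive_in `[0, 1] (fun y => m * eta y) 0.
  apply: touching_derive_left => // y y01; apply: (le_trans (sg_mul_le _ _)).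
  by rewrite -ler_pdivrMr ?eta0// umax.
rewrite Eev Eme => H.
rewrite ler_pdivlMl ?normr_gt0 ?lt_eqF// ltr0_norm//.
apply: (@le_trans _ _ (Num.sg (u t 0) * - robin0 mu0 lambda0 (u t))); last first.
  by rewrite (le_trans (sg_mul_le _ _))// normrN.
rewrite -/e /robin0.
have := ler_wpM2l (ltW mu00) H.
rewrite (_ : e * - _ = - (mu0 * (e * derive_in `[0, 1] (u t) 0)) + lambda0 * (e * u t 0)).
  by rewrite eq0; lra.
by ring.
Qed.

Lemma dirichlet_le_mixed1 (mu1 lambda1 : R) (eta : R -> R) (u : R -> R -> R) (t : R) :
  0 < mu1 -> 0 < robin1 mu1 lambda1 eta ->
  derivable_in `[0, 1] eta 1 -> derivable_in `[0, 1] (u t) 1 ->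
  (forall y, 0 <= y <= 1 -> 0 < eta y) ->
  (forall y, 0 <= y <= 1 -> `|u t y| / eta y <= `|u t 1| / eta 1) ->
  dirichlet eta u 1 t <= mixed1 mu1 lambda1 eta u t.
Proof.
move=> mu10 rob deta du eta0 umax.
have e10 : 0 < eta 1 by apply: eta0; rewrite lexx ler01.
rewrite /mixed1 le_min lexx /= /dirichlet.
set m := `|u t 1| / eta 1; set e := Num.sg (u t 1).
have PF := proper_increments_right (@ltr01 R).
have [dev Eev] := derive_in_scale e PF du.
have [dme Eme] := derive_in_scale m PF deta.
have eq1 : e * u t 1 = m * eta 1.
  by rewrite -normrEsg /m divfK// gt_eqF.
have : derive_in `[0, 1] (fun y => m * eta y) 1 <=
       derive_in `[0, 1] (fun y => e * u t y) 1.
  apply: touching_derive_right => // y y01; apply: (le_trans (sg_mul_le _ _)).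
  by rewrite -ler_pdivrMr ?eta0// umax.
rewrite Eev Eme => H.
rewrite ler_pdivlMl//; apply: (le_trans _ (sg_mul_le (u t 1) _)).
rewrite -/e /robin1.
have := ler_wpM2l (ltW mu10) H.
rewrite (_ : e * _ = mu1 * (e * derive_in `[0, 1] (u t) 1) + lambda1 * (e * u t 1)).
  by rewrite eq1; lra.
by ring.
Qed.

(** * Estimate by the data *)

(** The estimate with all data bounded by one constant [C]. The boundary
    hypothesis concerns only the times at which the weighted maximum is attained
    at an endpoint, and it covers Dirichlet and Robin data alike. *)
Lemma weighted_sup_bound (T : R) (a b c f u : R -> R -> R) (sigma zeta : R)
    (eta : R -> R) (t C : R) :
  {within `[0, T] `*` `[0, 1], continuous (fun p : R * R => u p.1 p.2)} ->
  {ae @lebesgue_measure R, forall t : R, 0 < t < T -> Ck 2 `]0, 1[ (u t)} ->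
  (forall t x : R, 0 < t < T -> 0 <= x <= 1 -> derivable (u ^~ x) t 1) ->
  {within `]0, T[ `*` `[0, 1],
    continuous (fun p : R * R => derive1 (u ^~ p.2) p.1)} ->
  {ae @lebesgue_measure R, forall t : R, 0 < t < T -> forall x : R, 0 < x < 1 ->
    derive1 (u ^~ x) t = a t x * derive1n 2 (u t) x + b t x * derive1 (u t) x
                     + c t x * u t x + f t x} ->
  (forall t x : R, 0 < t < T -> 0 < x < 1 -> 0 <= a t x) ->
  Ck 2 `[0, 1] eta ->
  (forall x : R, 0 <= x <= 1 -> 0 < eta x) ->
  (forall t x : R, 0 < t < T -> 0 < x < 1 ->
    a t x * derive_in_n `[0, 1] 2 eta x + b t x * derive_in `[0, 1] eta x
    + (sigma + c t x) * eta x <= 0) ->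
  zeta < sigma -> 0 < t <= T ->
  (forall x, 0 <= x <= 1 -> `|u 0 x| <= C * eta x) ->
  (forall s x, 0 < s < t -> x = 0 \/ x = 1 ->
    (forall y, 0 <= y <= 1 -> `|u s y| / eta y <= `|u s x| / eta x) ->
    `|u s x| * expR (zeta * s) <= C * eta x) ->
  (forall s x, 0 < s < t -> 0 < x < 1 ->
    `|f s x| * expR (zeta * s) <= (sigma - zeta) * (C * eta x)) ->
  forall x, 0 <= x <= 1 -> `|u t x| * expR (zeta * t) <= C * eta x.
Proof.
move=> cu aeC du cdu aePDE a0 Ceta eta0 supersol zs /andP[t0 tT] init bdry force.
have ceta : {within `[0, 1], continuous eta} by exact: (Ceta.2 0%N).
have [em em0 emP] := continuous_pos_lower_bound ler01 ceta eta0.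
move=> x0 x01; rewrite leNgt; apply/negP => above.
pose w s x := `|u s x| * expR (zeta * s).
have e0 := eta0 _ x01.
(* The barrier [L s * eta x] starts at [(C + g / 2) * eta x], strictly above the
   initial profile, and [L t = C + 3 g / 4] still lies below [w t x0 / eta x0]. *)
pose g := w t x0 / eta x0 - C.
have g0 : 0 < g by rewrite subr_gt0 ltr_pdivlMr.
pose k := g / (4 * t).
have k0 : 0 < k by rewrite divr_gt0// mulr_gt0.
have kt : k * t = g / 4 by rewrite /k; field; rewrite gt_eqF.
pose L s := C + g / 2 + k * s.
have cexp : {within `[0, T] `*` `[0, 1], continuous (fun p : R * R => expR (zeta * p.1))}.
  apply: continuous_subspaceT => p; apply: continuous_comp; last exact: continuous_expR.
  by apply: cvgM; [exact: cvg_cst|exact: cvg_fst].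
have cw : {within `[0, T] `*` `[0, 1], continuous (fun p : R * R => w p.1 p.2)}.
  by move=> p; apply: cvgM; [apply: cvg_norm; exact: cu|exact: cexp].
pose psi (p : R * R) := (derive1 (u ^~ p.2) p.1 + zeta * u p.1 p.2) * expR (zeta * p.1).
have sub : `]0, T[ `*` `[0, 1] `<=` `[0, T] `*` (`[0, 1] : set R).
  move=> p [/= p1 p2]; split => //=; exact: subset_itv_oo_cc p1.
have cpsi : {within `]0, T[ `*` `[0, 1], continuous psi}.
  move=> p; apply: cvgM; last exact: (continuous_subspaceW sub cexp).
  apply: cvgD; first exact: cdu.
  by apply: cvgM; [exact: cvg_cst|exact: (continuous_subspaceW sub cu)].
pose S := [set s : R | 0 <= s <= t /\ forall x, 0 <= x <= 1 -> w s x <= L s * eta x].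
have S0 : S 0.
  split=> [|x xin]; first by rewrite lexx ltW.
  rewrite /w /L mulr0 expR0 mulr1 mulr0 addr0 (le_trans (init x xin))//.
  by rewrite ler_wpM2r ?ltW ?eta0// ltrDl divr_gt0.
have Lg s : L s = C + g / 2 + k * s by [].
have St : ~ S t.
  move=> [_ /(_ _ x01)]; rewrite -ler_pdivrMr// Lg kt.
  have -> : w t x0 / eta x0 = C + g by rewrite /g addrC subrK.
  lra.
have tT0 : `[0, t] `<=` (`[0, T] : set R).
  by move=> s /=; rewrite !in_itv /= => /andP[-> st]; exact: le_trans st tT.
have cS : closed S.
  rewrite (_ : S = \bigcap_(x in `[0, 1])
      (`[0, t] `&` [set s | w s x - L s * eta x <= 0])); last first.
    rewrite eqEsubset; split=> s.
      move=> [st Hs] x /=; rewrite !in_itv /= => xin; split=> //.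
      by rewrite subr_le0 Hs.
    move=> Hs; split=> [|x xin].
      by have [] := Hs x0 _; rewrite /= in_itv.
    by have [|_] := Hs x _; rewrite /= ?in_itv //= subr_le0.
  apply: closed_bigI => x xin; apply: closed_le0_within; first exact: itv_closed.
  have cwx : {within `[0, t], continuous (w ^~ x)}.
    exact: (continuous_subspaceW tT0 (within_continuous_pairl xin cw)).
  move=> s; apply: cvgB; first exact: cwx.
  have : {within `[0, t], continuous (fun s => L s * eta x)}; last exact.
  apply: continuous_subspaceT => r; apply: cvgM; last exact: cvg_cst.
  by apply: cvgD; [exact: cvg_cst|apply: cvgM; [exact: cvg_cst|exact: cvg_id]].
have [p [/andP[p0 pt] Sp lastp]] :
    exists p, [/\ 0 <= p < t, S p & forall s, p < s -> ~ S s].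
  by apply: last_time => // s [st _]; rewrite /= in_itv.
have compact01 : compact (`[0, 1] : set R) by exact: segment_compact.
have T0 : 0 < T by exact: lt_le_trans t0 tT.
(* Continuity of [u_t] is available for times in ]0, T[ only. The last time is
   positive because [w] stays below the barrier for a short time, uniformly in [x]. *)
have {}p0 : 0 < p.
  have z0T : (`[0, T] : set R) 0 by rewrite /= in_itv /= lexx ltW.
  have ge0 : 0 < g / 2 * em by rewrite mulr_gt0// divr_gt0.
  have /nbhs_ballP [d /= d0 Hd] := tube_lt compact01 cw z0T ge0.
  have [s [s0 st sd]] := exists_pos_lt2 t0 d0.
  have Ss : S s.
    split=> [|x xin]; first by rewrite !ltW.
    have bs : ball 0 d s by rewrite /ball /= sub0r normrN gtr0_norm.
    have sT : (`[0, T] : set R) s.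
      by rewrite /= in_itv /= (ltW s0) (ltW (lt_le_trans st tT)).
    have xin' : (`[0, 1] : set R) x by rewrite /= in_itv.
    have := Hd s bs sT x xin'; rewrite ltr_distl => /andP[_ /=] H.
    have w0 : w 0 x <= C * eta x by rewrite /w mulr0 expR0 mulr1; exact: init.
    have : g / 2 * em <= g / 2 * eta x by rewrite ler_wpM2l ?emP// ltW// divr_gt0.
    have : 0 <= k * s * eta x.
      by rewrite mulr_ge0 ?(ltW (eta0 _ xin))// mulr_ge0 ?(ltW k0)// ltW.
    rewrite Lg; lra.
  by rewrite ltNge; apply/negP => ps; apply: (lastp s) => //; exact: le_lt_trans ps s0.
have pT : (`]0, T[ : set R) p by rewrite /= in_itv /= p0 (lt_le_trans pt tT).
have e20 : 0 < k * em / 2 by rewrite divr_gt0// mulr_gt0.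
have /nbhs_ballP [d /= d0 Hd] := tube_lt compact01 cpsi pT e20.
have pq : p < Num.min t (p + d) by rewrite lt_min pt ltrDl.
have [s /andP[ps]] := ae_between pq (ae_and aeC aePDE).
rewrite lt_min => /andP[st spd] [Cs PDE].
have s0T : 0 < s < T by rewrite (lt_trans p0 ps) (lt_le_trans st tT).
have s0t : 0 < s < t by rewrite (lt_trans p0 ps) st.
have {}Cs := Cs s0T; have {}PDE := PDE s0T.
have sin : (`]0, T[ : set R) s by rewrite /= in_itv.
have cus : {within `[0, 1], continuous (u s)}.
  by apply: (within_continuous_pairr _ cu); exact: subset_itv_oo_cc sin.
have [x xin [_ xmax]] := wnorm_attained ceta cus eta0.
have ex := eta0 _ xin.
have es0 : 0 < expR (zeta * s) by exact: expR_gt0.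
(* Some point lies above the barrier at time [s], and [x] maximises the ratio
   [w s x / eta x], hence lies above it too. *)
have big : L s * eta x < w s x.
  rewrite ltNge; apply/negP => H; apply: (lastp _ ps); split=> [|y yin].
    by case/andP: s0t => ? ?; rewrite !ltW.
  have ey := eta0 _ yin.
  have := xmax y yin; rewrite ler_pdivrMr// => Hy.
  rewrite /w (le_trans (ler_wpM2r (ltW es0) Hy))//.
  rewrite mulrAC ler_wpM2r ?(ltW ey)// mulrAC ler_pdivrMr//.
have Cbig : C * eta x < w s x.
  apply: le_lt_trans big; rewrite ler_wpM2r ?(ltW ex)// Lg.
  have : 0 <= k * s by rewrite mulr_ge0 ?(ltW k0)//; case/andP: s0t => /ltW.
  lra.
pose e := Num.sg (u s x).
pose v tau := e * u tau x * expR (zeta * tau).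
have vs : v s = w s x by rewrite /v /w /e -normrEsg.
have vp : v p <= w p x by rewrite /v /w ler_wpM2r ?expR_ge0// sg_mul_le.
have xin' : (`[0, 1] : set R) x by rewrite /= in_itv.
have dv tau : 0 < tau < T -> is_derive tau 1 v (e * psi (tau, x)).
  move=> tauT.
  have D1 : is_derive tau 1 (u ^~ x) (derive1 (u ^~ x) tau).
    by rewrite derive1E; exact/derivableP/du.
  exact: is_derive_expR_weighted.
have [xi xip vE] : exists2 xi, xi \in `]p, s[%R & v s - v p = e * psi (xi, x) * (s - p).
  have ok tau : p <= tau <= s -> 0 < tau < T.
    by move=> /andP[H1 H2]; rewrite (lt_le_trans p0 H1) (le_lt_trans H2)//; case/andP: s0T.
  apply: (MVT (df := fun tau => e * psi (tau, x))) => //.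
    by move=> tau; rewrite in_itv /= => /andP[H1 H2]; apply/dv/ok; rewrite !ltW.
  apply: derivable_within_continuous => tau; rewrite in_itv /= => H.
  by have [] := dv _ (ok _ H).
(* [psi] is the time derivative of [u exp(zeta t)]. The weighted solution crosses
   from below the barrier at [p] to above it at [s], so it grows faster than the
   barrier somewhere in between. *)
have psi_xi : k * em < e * psi (xi, x).
  have sp0 : 0 < s - p by rewrite subr_gt0.
  rewrite -(ltr_pM2r sp0) -vE; apply: (@le_lt_trans _ _ (k * (s - p) * eta x)).
    by rewrite mulrAC ler_wpM2l ?emP// mulr_ge0// ltW.
  have wp := Sp.2 x xin.
  apply: (@lt_le_trans _ _ (w s x - w p x)); last by rewrite vs lerB.
  apply: (@lt_le_trans _ _ (w s x - L p * eta x)); last by rewrite lerB.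
  rewrite ltrBrDl (le_lt_trans _ big)// !Lg; lra.
have close tau : p < tau < p + d -> tau < T -> `|psi (tau, x) - psi (p, x)| < k * em / 2.
  move=> /andP[H1 H2] H3; apply: (Hd tau) => //.
    by rewrite /ball /= distrC gtr0_norm ?subr_gt0// ltrBlDl.
  by rewrite /= in_itv /= (lt_trans p0 H1).
(* Both [xi] and [s] are close to [p], so [psi] differs at the two times by less
   than [k * em]. *)
have psi_s : 0 < e * psi (s, x).
  move: xip; rewrite in_itv /= => /andP[pxi xis].
  have sT : s < T by case/andP: s0T.
  have c1 := close xi _ (lt_trans xis sT).
  have {}c1 : `|psi (xi, x) - psi (p, x)| < k * em / 2.
    by apply: c1; rewrite pxi (lt_trans xis spd).
  have c2 : `|psi (s, x) - psi (p, x)| < k * em / 2.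
    by apply: close => //; rewrite ps spd.
  have := le_lt_trans (sg_mul_le (u s x) _) c1.
  rewrite distrC in c2; have := le_lt_trans (sg_mul_le (u s x) _) c2.
  rewrite -/e; move: psi_xi; clear.
  move: (psi (xi, x)) (psi (p, x)) (psi (s, x)) => A B D; lra.
have [/bdry|nbd] := pselect (x = 0 \/ x = 1).
  by move=> /(_ s s0t xmax); rewrite leNgt Cbig.
have x01' : 0 < x < 1.
  case/andP: xin => x0' x1'; rewrite !lt_neqAle x0' x1' !andbT.
  by apply/andP; split; apply/eqP => E; apply: nbd; [left|right].
have uE : e * u s x = `|u s x| by rewrite /e -normrEsg.
have ellip : e * (a s x * derive1n 2 (u s) x + b s x * derive1 (u s) x + c s x * u s x)
    <= - sigma * `|u s x|.
  have mE : `|u s x| / eta x * eta x = `|u s x| by rewrite divfK// gt_eqF.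
  rewrite -[in leRHS]mE; apply: elliptic_at_interior_max => //.
  - by rewrite divr_ge0// ltW.
  - move=> y yin; apply: (le_trans (sg_mul_le _ _)).
    by rewrite -ler_pdivrMr ?eta0// xmax.
  - by rewrite mE.
  - exact: a0.
  - exact: supersol.
have small_force : `|f s x| < (sigma - zeta) * `|u s x|.
  rewrite -(ltr_pM2r es0); apply: (le_lt_trans (force s x s0t x01')).
  by rewrite -mulrA ltr_pM2l ?subr_gt0.
move: psi_s; rewrite /psi /= PDE// mulrA pmulr_lgt0//; apply/negP; rewrite -leNgt.
have ef := sg_mul_le (u s x) (f s x); rewrite -/e in ef.
move: ellip small_force ef uE; clear.
move: (a s x * _) (b s x * _) (c s x * _) => A B D.
move=> ellip small_force ef uE.
rewrite (_ : e * _ = e * (A + B + D) + e * f s x + zeta * (e * u s x)); last by ring.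
rewrite uE; lra.
Qed.

(** The three choices of boundary data share two properties: they do not exceed
    the Dirichlet data, so that the supremum in the estimate is finite, and they
    dominate the weighted maximum whenever it is attained at that endpoint. *)
Lemma estimate_of_boundary (T : R) (a b c f u : R -> R -> R) (sigma : R)
    (eta : R -> R) (r0 r1 : R -> R) :
  has_ubound [set `|f p.1 p.2| | p in `]0, T] `*` `]0, 1[] ->
  {within `[0, T] `*` `[0, 1], continuous (fun p : R * R => u p.1 p.2)} ->
  {ae @lebesgue_measure R, forall t : R, 0 < t < T -> Ck 2 `]0, 1[ (u t)} ->
  (forall t x : R, 0 < t < T -> 0 <= x <= 1 -> derivable (u ^~ x) t 1) ->
  {within `]0, T[ `*` `[0, 1],
    continuous (fun p : R * R => derive1 (u ^~ p.2) p.1)} ->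
  {ae @lebesgue_measure R, forall t : R, 0 < t < T -> forall x : R, 0 < x < 1 ->
    derive1 (u ^~ x) t = a t x * derive1n 2 (u t) x + b t x * derive1 (u t) x
                     + c t x * u t x + f t x} ->
  (forall t x : R, 0 < t < T -> 0 < x < 1 -> 0 <= a t x) ->
  Ck 2 `[0, 1] eta ->
  (forall x : R, 0 <= x <= 1 -> 0 < eta x) ->
  (forall t x : R, 0 < t < T -> 0 < x < 1 ->
    a t x * derive_in_n `[0, 1] 2 eta x + b t x * derive_in `[0, 1] eta x
    + (sigma + c t x) * eta x <= 0) ->
  (forall s, 0 < s <= T -> r0 s <= dirichlet eta u 0 s) ->
  (forall s, 0 < s <= T -> r1 s <= dirichlet eta u 1 s) ->
  (forall s, 0 < s <= T ->
    (forall y, 0 <= y <= 1 -> `|u s y| / eta y <= `|u s 0| / eta 0) ->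
    dirichlet eta u 0 s <= r0 s) ->
  (forall s, 0 < s <= T ->
    (forall y, 0 <= y <= 1 -> `|u s y| / eta y <= `|u s 1| / eta 1) ->
    dirichlet eta u 1 s <= r1 s) ->
  estimate T sigma eta u f r0 r1.
Proof.
move=> [Bf Bfub] cu aeC du cdu aePDE a0 Ceta eta0 supersol r0D r1D Dr0 Dr1.
move=> zeta t /andP[z0 zs] /[dup] tT' /andP[t0 tT].
have ceta : {within `[0, 1], continuous eta} by exact: (Ceta.2 0%N).
have [em em0 emP] := continuous_pos_lower_bound ler01 ceta eta0.
have T0 : 0 < T by exact: lt_le_trans t0 tT.
have sz0 : 0 < sigma - zeta by rewrite subr_gt0.
have in0 : 0 <= (0 : R) <= 1 by rewrite lexx ler01.
have in1 : 0 <= (1 : R) <= 1 by rewrite lexx ler01.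
have cus s : 0 <= s <= T -> {within `[0, 1], continuous (u s)}.
  by move=> sT; apply: (within_continuous_pairr _ cu); rewrite /= in_itv.
have ubD x : 0 <= x <= 1 ->
    exists2 D, 0 <= D & forall s, 0 < s <= T -> dirichlet eta u x s <= D.
  move=> xin; have xin' : (`[0, 1] : set R) x by rewrite /= in_itv.
  have cx : {within `[0, T], continuous (fun s => `|u s x|)}.
    move=> s; apply: cvg_norm; exact: (within_continuous_pairl xin' cu).
  have [s0 s0T smax] := EVT_max (ltW T0) cx.
  exists (`|u s0 x| / eta x); first by rewrite divr_ge0// ltW// eta0.
  move=> s /andP[s1 s2]; rewrite /dirichlet ler_wpM2r ?invr_ge0 ?(ltW (eta0 _ xin))//.
  by apply: smax; rewrite in_itv /= ltW.
have [D0 D00 D0P] := ubD 0 in0.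
have [D1 D10 D1P] := ubD 1 in1.
have fB s x : 0 < s <= T -> 0 < x < 1 -> `|f s x| / eta x <= Bf / em.
  move=> sT xin.
  have fle : `|f s x| <= Bf by apply: Bfub; exists (s, x) => //=; rewrite !in_itv.
  have emx : em <= eta x by apply: emP; case/andP: xin => /ltW-> /ltW->.
  apply: ler_pM => //; first by rewrite invr_ge0 (le_trans (ltW em0)).
  by rewrite lef_pV2// posrE (lt_le_trans em0).
pose F s := wnorm (`]0, 1[) eta (f s).
have half : 0 < (2^-1 : R) < 1 by lra.
have fF s x : 0 < s <= T -> 0 < x < 1 -> `|f s x| / eta x <= F s.
  move=> sT xin; apply: ub_le_sup; last by exists x => //=; rewrite in_itv.
  by exists (Bf / em) => _ [y /= + <-]; rewrite in_itv; exact: fB.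
have FB s : 0 < s <= T -> F s <= Bf / em.
  move=> sT; apply: ge_sup.
    by exists (`|f s 2^-1| / eta 2^-1), 2^-1 => //=; rewrite in_itv.
  by move=> _ [y /= + <-]; rewrite in_itv; exact: fB.
have Bf0 : 0 <= Bf / em.
  by apply: le_trans (fB t 2^-1 tT' half); rewrite divr_ge0// ltW// eta0// !ltW; lra.
pose val s := Num.max (Num.max (r0 s) (r1 s)) (F s / (sigma - zeta)).
set E := [set _ | s in _].
have Eub : has_ubound E.
  have Q0 : 0 <= Bf / em / (sigma - zeta) by rewrite divr_ge0// ltW.
  exists (D0 + D1 + Bf / em / (sigma - zeta)) => _ [s /= + <-].
  rewrite in_itv /= => /andP[s0 st].
  have sT : 0 < s <= T by rewrite s0 (le_trans st tT).
  have e1 : expR (- zeta * (t - s)) <= 1.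
    by rewrite -expR0 ler_expR mulNr oppr_le0 mulr_ge0// subr_ge0.
  have vB : val s <= D0 + D1 + Bf / em / (sigma - zeta).
    rewrite !ge_max -andbA; apply/and3P; split.
    - by have := le_trans (r0D _ sT) (D0P _ sT); lra.
    - by have := le_trans (r1D _ sT) (D1P _ sT); lra.
    - have : F s / (sigma - zeta) <= Bf / em / (sigma - zeta).
        by rewrite ler_wpM2r ?FB// invr_ge0 ltW.
      lra.
  apply: (le_trans (ler_wpM2r (expR_ge0 _) vB)).
  by rewrite ler_piMr//; lra.
set W := wnorm _ eta (u 0).
pose M := Num.max (expR (- zeta * t) * W) (sup E).
rewrite -/M; pose C := M * expR (zeta * t).
have tin : 0 <= t <= T by rewrite ltW.
have valC s : 0 < s <= t -> val s * expR (zeta * s) <= C.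
  move=> st; have : val s * expR (- zeta * (t - s)) <= M.
    rewrite /M le_max; apply/orP; right; apply: ub_le_sup => //.
    by exists s => //=; rewrite in_itv.
  rewrite -(ler_pM2r (expR_gt0 (zeta * t))) -mulrA -expRD.
  by rewrite (_ : - zeta * (t - s) + zeta * t = zeta * s)//; ring.
have WC : W <= C.
  have : expR (- zeta * t) * W <= M by rewrite /M le_max lexx.
  rewrite -(ler_pM2r (expR_gt0 (zeta * t))) mulrAC -expRD.
  by rewrite mulNr addNr expR0 mul1r.
have key : forall x, 0 <= x <= 1 -> `|u t x| * expR (zeta * t) <= C * eta x.
  apply: (weighted_sup_bound cu aeC du cdu aePDE a0 Ceta eta0 supersol zs tT').
  - move=> x xin; rewrite -ler_pdivrMr ?eta0//; apply: le_trans WC.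
    have z0T : 0 <= (0 : R) <= T by rewrite lexx ltW.
    have [x0 x0in [WE xmax]] := wnorm_attained ceta (cus 0 z0T) eta0.
    by rewrite /W WE; exact: xmax.
  - move=> s x /andP[s0 st] x01 xmax.
    have sT : 0 < s <= T by rewrite s0 (ltW (lt_le_trans st tT)).
    have xin : 0 <= x <= 1 by case: x01 => ->.
    have st' : 0 < s <= t by rewrite s0 ltW.
    rewrite -ler_pdivrMr ?eta0// mulrAC; apply: le_trans (valC s st').
    rewrite ler_wpM2r ?expR_ge0// /val !le_max.
    by case: x01 xmax => -> xmax; rewrite ?(Dr0 s sT xmax) ?(Dr1 s sT xmax) ?orbT.
  - move=> s x /andP[s0 st] xin.
    have sT : 0 < s <= T by rewrite s0 (ltW (lt_le_trans st tT)).
    have st' : 0 < s <= t by rewrite s0 ltW.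
    have ex : 0 < eta x by apply: eta0; case/andP: xin => /ltW-> /ltW->.
    rewrite mulrA -ler_pdivrMr// mulrAC mulrC -ler_pdivrMl//.
    rewrite mulrCA mulrC; apply: le_trans (valC s st').
    rewrite ler_wpM2r ?expR_ge0// /val le_max; apply/orP; right.
    by rewrite mulrC ler_wpM2r ?fF// invr_ge0 ltW.
have [x xin [-> _]] := wnorm_attained ceta (cus t tin) eta0.
rewrite -(ler_pM2r (expR_gt0 (zeta * t))) -/C.
by rewrite mulrAC ler_pdivrMr ?eta0// key.
Qed.

End maximum_principle.

Unset Implicit Arguments.

Theorem corollary2p3 (R : realType) (T : R) (a b c f u : R -> R -> R)
    (mu0 mu1 lambda0 lambda1 sigma : R) (eta : R -> R) :
  0 < T ->
  has_ubound [set `|f p.1 p.2| | p in `]0, T] `*` `]0, 1[] ->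
  {within `[0, T] `*` `[0, 1], continuous (fun p : R * R => u p.1 p.2)} ->
  {ae @lebesgue_measure R, forall t : R, 0 < t < T -> Ck 2 `]0, 1[ (u t)} ->
  (forall t x : R, 0 < t < T -> 0 <= x <= 1 -> derivable (u ^~ x) t 1) ->
  {within `]0, T[ `*` `[0, 1],
    continuous (fun p : R * R => derive1 (u ^~ p.2) p.1)} ->
  (forall t : R, 0 < t <= T ->
    derivable_in `[0, 1] (u t) 0 /\ derivable_in `[0, 1] (u t) 1) ->
  {ae @lebesgue_measure R, forall t : R, 0 < t < T -> forall x : R, 0 < x < 1 ->
    derive1 (u ^~ x) t = a t x * derive1n 2 (u t) x + b t x * derive1 (u t) x
                     + c t x * u t x + f t x} ->
  0 < mu0 -> 0 < mu1 ->
  (forall t x : R, 0 < t < T -> 0 < x < 1 -> 0 <= a t x) ->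
  0 < sigma ->
  Ck 2 `[0, 1] eta ->
  (forall x : R, 0 <= x <= 1 -> 0 < eta x) ->
  (forall t x : R, 0 < t < T -> 0 < x < 1 ->
    a t x * derive_in_n `[0, 1] 2 eta x + b t x * derive_in `[0, 1] eta x
    + (sigma + c t x) * eta x <= 0) ->
  [/\ robin0 mu0 lambda0 eta < 0 ->
        estimate T sigma eta u f
          (mixed0 mu0 lambda0 eta u) (dirichlet eta u 1),
      0 < robin1 mu1 lambda1 eta ->
        estimate T sigma eta u f
          (dirichlet eta u 0) (mixed1 mu1 lambda1 eta u) &
      robin0 mu0 lambda0 eta < 0 /\ 0 < robin1 mu1 lambda1 eta ->
        estimate T sigma eta u f
          (mixed0 mu0 lambda0 eta u) (mixed1 mu1 lambda1 eta u)].
Proof.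
move=> _ bf cu aeC du cdu dbd aePDE mu00 mu10 a0 _ Ceta eta0 supersol.
have main := estimate_of_boundary bf cu aeC du cdu aePDE a0 Ceta eta0 supersol.
have deta x : 0 <= x <= 1 -> derivable_in `[0, 1] eta x.
  by move=> xin; apply: (Ceta.1 0%N x isT); rewrite /= in_itv.
have deta0 : derivable_in `[0, 1] eta 0 by apply: deta; rewrite lexx ler01.
have deta1 : derivable_in `[0, 1] eta 1 by apply: deta; rewrite lexx ler01.
have mixed0_le s : mixed0 mu0 lambda0 eta u s <= dirichlet eta u 0 s.
  by rewrite ge_min lexx.
have mixed1_le s : mixed1 mu1 lambda1 eta u s <= dirichlet eta u 1 s.
  by rewrite ge_min lexx.
have at0 := dirichlet_le_mixed0 mu00 _ deta0 (dbd _ _).1 eta0.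
have at1 := dirichlet_le_mixed1 mu10 _ deta1 (dbd _ _).2 eta0.
split=> [rob0|rob1|[rob0 rob1]]; apply: main => // s sT; by [exact: at0|exact: at1].
Qed.
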